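(* Let $\alpha_1,\alpha_2,\alpha_3>0$, $\lambda_1,\lambda_2,\lambda_3\ge0$, $\lambda^+=\lambda_1+\lambda_2+\lambda_3$, and let $(X''_1,X''_2)$ have the bivariate Conditional Non-central Dirichlet distribution $\mathrm{CNcDir}^2(\alpha_1,\alpha_2,\alpha_3,\lambda_1,\lambda_2,\lambda_3)$, with density $f(x_1,x_2)$ on $\mathcal S^2$. Then the limiting values of $f$ at the vertices of the simplex are as follows. As $(x_1,x_2)\to(1,0)$: - if $\alpha_2+\alpha_3<2$, then $f(x_1,x_2)\to+\infty$; - if $\alpha_2+\alpha_3=2$: if $\alpha_2=\alpha_3=1$, then $f(x_1,x_2)\to\alpha_1(\alpha_1+1)\,\dfrac{{}_0F_1\left(\alpha_1;\frac{\lambda_1}{4}\right)}{{}_0F_1\left(\alpha_1+2;\frac{\lambda^+}{4}\right)}$; otherwise the limit does not exist; - if $\alpha_2+\alpha_3>2$, then $f(x_1,x_2)\to0$. As $(x_1,x_2)\to(0,1)$: - if $\alpha_1+\alpha_3<2$, then $f(x_1,x_2)\to+\infty$; - if $\alpha_1+\alpha_3=2$: if $\alpha_1=\alpha_3=1$, then $f(x_1,x_2)\to\alpha_2(\alpha_2+1)\,\dfrac{{}_0F_1\left(\alpha_2;\frac{\lambda_2}{4}\right)}{{}_0F_1\left(\alpha_2+2;\frac{\lambda^+}{4}\right)}$; otherwise the limit does not exist; - if $\alpha_1+\alpha_3>2$, then $f(x_1,x_2)\to0$. As $(x_1,x_2)\to(0,0)$: - if $\alpha_1+\alpha_2<2$,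 then $f(x_1,x_2)\to+\infty$; - if $\alpha_1+\alpha_2=2$: if $\alpha_1=\alpha_2=1$, then $f(x_1,x_2)\to\alpha_3(\alpha_3+1)\,\dfrac{{}_0F_1\left(\alpha_3;\frac{\lambda_3}{4}\right)}{{}_0F_1\left(\alpha_3+2;\frac{\lambda^+}{4}\right)}$; otherwise the limit does not exist; - if $\alpha_1+\alpha_2>2$, then $f(x_1,x_2)\to0$. In each case where the limit is said not to exist, this is because it depends on the direction followed to reach the accumulation point under consideration.
   Context: Notation: $\mathcal S^2=\{(x_1,x_2):0<x_1<1,\ 0<x_2<1,\ x_1+x_2<1\}$; $(a)_l=\Gamma(a+l)/\Gamma(a)$; ${}_0F_1(b;x)=\sum_{i\ge0}\frac{1}{(b)_i}\frac{x^i}{i!}$. The bivariate Conditional Non-central Dirichlet distribution $\mathrm{CNcDir}^2(\alpha_1,\alpha_2,\alpha_3,\lambda_1,\lambda_2,\lambda_3)$ is the law of $(Y'_1/Y'^+,Y'_2/Y'^+)$ conditionally on $Y'^+=1$, where $Y'_1,Y'_2,Y'_3$ are independent Non-central Chi-Squared random variables, $Y'_i$ having $2\alpha_i$ degrees of freedom and non-centrality parameter $\lambda_i$, and $Y'^+=Y'_1+Y'_2+Y'_3$. With $\alpha^+=\alpha_1+\alpha_2+\alpha_3$ and $x_3=1-x_1-x_2$, its density is $$f(x_1,x_2)=\frac{\Gamma(\alpha^+)}{\Gamma(\alpha_1)\Gamma(\alpha_2)\Gamma(\alpha_3)}\,x_1^{\alpha_1-1}x_2^{\alpha_2-1}x_3^{\alpha_3-1}\cdot\frac{\prod_{i=1}^3{}_0F_1\left(\alpha_i;\frac{\lambda_i}{4}x_i\right)}{{}_0F_1\left(\alpha^+;\frac{\lambda^+}{4}\right)},\qquad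 (x_1,x_2)\in\mathcal S^2 .$$
   Formalization: The limits +∞ (sum < 2) and 0 (sum > 2) fail along curves tangent to an edge if one of the two parameters is < 1 and the other > 1; they are stated along every direction into the simplex, and as unrestricted limits when both parameters are ≤ 1 (for +∞) or both ≥ 1 (for 0). *)

(* Defs.v *)
From mathcomp Require Import all_boot all_order all_algebra.
From mathcomp Require Import all_classical all_reals all_analysis.

Set Implicit Arguments.
Unset Strict Implicit.
Unset Printing Implicit Defensive.

Import Order.TTheory GRing.Theory Num.Theory.
Import numFieldNormedType.Exports.

Local Open Scope classical_set_scope.
Local Open Scope ring_scope.

Section CNcDir.
Context {R : realType}.

(* Euler's integral; only used at positive arguments, where it is finite. *)
Definition Gamma (a : R) : R :=
  \int[lebesgue_measure]_(t in `]0, +oo[) (t `^ (a - 1) * expR (- t)).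

Definition poch (a : R) (l : nat) : R := Gamma (a + l%:R) / Gamma a.

Definition hyp0F1 (b x : R) : R :=
  limn (pseries (fun i => (poch b i)^-1 * (i`!%:R)^-1) x).

Definition simplex2 : set (R * R) :=
  [set x | 0 < x.1 < 1 /\ 0 < x.2 < 1 /\ x.1 + x.2 < 1].

(* A density on simplex2; its values off simplex2 carry no meaning. *)
Definition cncdir_pdf (a1 a2 a3 l1 l2 l3 : R) (x : R * R) : R :=
  let ap := a1 + a2 + a3 in
  let lp := l1 + l2 + l3 in
  let x1 := x.1 in let x2 := x.2 in let x3 := 1 - x.1 - x.2 in
  Gamma ap / (Gamma a1 * Gamma a2 * Gamma a3)
  * (x1 `^ (a1 - 1) * x2 `^ (a2 - 1) * x3 `^ (a3 - 1))
  * (hyp0F1 a1 (l1 / 4 * x1) * hyp0F1 a2 (l2 / 4 * x2) * hyp0F1 a3 (l3 / 4 * x3)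
     / hyp0F1 ap (lp / 4)).

(* Unrestricted two-variable limit from inside the simplex. *)
Definition lim_simplex (f : R * R -> R) (v : R * R) (l : \bar R) : Prop :=
  (f x)%:E @[x --> within simplex2 (nbhs v)] --> l.

Definition inward (v u : R * R) : Prop :=
  \forall t \near 0^'+, simplex2 (v.1 + t * u.1, v.2 + t * u.2).

(* Limit at v when v is reached in the direction u: x = v + t w with t -> 0+
   and w -> u.  This covers the ray v + t u as well as every curve ending at v
   with tangent direction u; for u inward such x eventually lie in simplex2. *)
Definition lim_dir (f : R * R -> R) (v u : R * R) (l : \bar R) : Prop :=
  (f (v.1 + p.1 * p.2.1, v.2 + p.1 * p.2.2))%:E
    @[p --> filter_prod 0^'+ (nbhs u)] --> l.

(* The limit along every direction pointing into the simplex.  It is weaker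
   than lim_simplex, and for the densities above strictly so: with a2 = 1/4 and
   a3 = 3/2 the density at (1,0) behaves like x2^(-3/4) * x3^(1/2), which tends
   to +oo in every inward direction but to 0 along the curve x3 = x2^2, tangent
   to the boundary. *)
Definition lim_alldir (f : R * R -> R) (v : R * R) (l : \bar R) : Prop :=
  forall u, inward v u -> lim_dir f v u l.

Definition direction_dependent (f : R * R -> R) (v : R * R) : Prop :=
  exists l : R * R -> \bar R,
    (forall u, inward v u -> lim_dir f v u (l u)) /\
    (exists u u', [/\ inward v u, inward v u' & l u <> l u']).

Definition no_limit (f : R * R -> R) (v : R * R) : Prop :=
  ~ (exists l : \bar R, lim_simplex f v l) /\ direction_dependent f v.

End CNcDir.

(* Main.v *)
Require Import Defs.
From mathcomp Require Import all_boot all_order all_algebra.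
From mathcomp Require Import all_classical all_reals all_analysis.
From mathcomp Require Import measurable_realfun ring lra.

Set Implicit Arguments.
Unset Strict Implicit.
Unset Printing Implicit Defensive.

Import Order.TTheory GRing.Theory Num.Theory.
Import numFieldNormedType.Exports.

Local Open Scope classical_set_scope.
Local Open Scope ring_scope.

(* Near a vertex v the density is g * P^a * Q^b, where P and Q are the
   barycentric coordinates vanishing at v, a and b the corresponding Dirichlet
   parameters minus one, and g is continuous at v with g(v) > 0.  Along
   x = v + t w this equals g(x) t^(a+b) P(w)^a Q(w)^b by homogeneity of P and
   Q, so t^(a+b) decides the limit in a fixed direction; when a + b = 0 and
   a <> 0 the limit g(v) (P(u) / Q(u))^a depends on the direction u.  When a
   and b have the same sign, P^a and Q^b have limits whose product is never
   0 * oo, which gives the unrestricted limit.  Positivity and continuity of g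
   rest on the functional equation of Gamma, which also makes the coefficients
   of 0F1 smaller than those of an exponential series. *)

(** * Improper integrals over the open half-line *)

Section HalfLine.
Context {R : realType}.
Local Notation mu := (@lebesgue_measure R).
Implicit Types (f F : R -> R).

Lemma continuous_measurable_itv0y f :
  (forall x : R, 0 < x -> {for x, continuous f}) ->
  measurable_fun (`]0, +oo[%classic : set R) (EFin \o f).
Proof.
move=> cf; apply/measurable_EFinP; apply: open_continuous_measurable_fun => //.
by move=> x; rewrite inE /= in_itv /= andbT; exact: cf.
Qed.

(** The integrand may blow up at 0, so the theorem is applied on the closed half-lines from 1/(n+1),
    where [f] is continuous. Monotone convergence, available because [f] is nonnegative, then passes
    to their union. *)
Lemma ge0_FTC_itv0y f F (A B : R) :
  (forall x : R, 0 < x -> 0 <= f x) ->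
  (forall x : R, 0 < x -> {for x, continuous f}) ->
  (forall x : R, 0 < x -> is_derive x 1 F (f x)) ->
  F x @[x --> 0^'+] --> A -> F x @[x --> +oo] --> B ->
  (\int[mu]_(x in `]0%R, +oo[) (f x)%:E = (B - A)%:E)%E.
Proof.
move=> f0 cf dF FA FB.
pose E (n : nat) : set R := `[n.+1%:R^-1, +oo[%classic.
have gt0E n x : E n x -> 0 < x.
  by rewrite /E /= in_itv /= andbT; apply: lt_le_trans.
have intE n : (\int[mu]_(x in E n) (f x)%:E = (B - F n.+1%:R^-1)%:E)%E.
  have n0 : 0 < n.+1%:R^-1 :> R by rewrite invr_gt0.
  rewrite EFinB; apply: (@ge0_continuous_FTC2y R f F) => //.
  - by move=> x nx; apply/f0/(lt_le_trans n0).
  - apply: continuous_in_subspaceT => x; rewrite inE => /gt0E; exact: cf.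
  - by move=> x nx; case: (dF x (lt_trans n0 nx)).
  - apply: cvg_at_right_filter; apply: differentiable_continuous.
    by apply/derivable1_diffP; case: (dF _ n0).
  - move=> x; rewrite in_itv /= andbT => nx.
    by rewrite derive1E; case: (dF x (lt_trans n0 nx)).
have bigE : \bigcup_i E i = `]0%R, +oo[%classic.
  apply/seteqP; split => x /=.
    by move=> [n _ /gt0E x0]; rewrite in_itv /= andbT.
  rewrite in_itv /= andbT => x0.
  (* Truncation gives 1/x < n + 1, hence 1/(n+1) <= x. *)
  exists (Num.truncn x^-1) => //; rewrite /E /= in_itv /= andbT.
  rewrite -[leRHS]invrK lef_pV2 ?posrE ?invr_gt0//.
  exact/ltW/Num.Theory.truncnS_gt.
have cvgE : (\int[mu]_(x in E n) (f x)%:E)%E @[n --> \oo] -->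
    (\int[mu]_(x in `]0%R, +oo[) (f x)%:E)%E.
  rewrite -bigE; apply: ge0_nondecreasing_set_cvg_integral.
  - move=> m n mn; rewrite subsetEset => x; rewrite /E /= !in_itv /= !andbT.
    by apply: le_trans; rewrite lef_pV2 ?posrE// ler_nat.
  - by move=> n; exact: measurable_itv.
  - move=> n; apply: measurable_funS (continuous_measurable_itv0y cf) => // x /gt0E.
    by rewrite /= in_itv /= andbT.
  - by move=> n x /gt0E x0; rewrite lee_fin f0.
rewrite -(cvg_lim _ cvgE)//; apply/cvg_lim => //.
under eq_fun do rewrite intE.
apply: cvg_EFin; first exact: nearW.
apply: cvgB; first exact: cvg_cst.
move/cvg_at_rightP: FA; apply; split; first by move=> n; rewrite invr_gt0.
exact: cvg_harmonic.
Qed.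

End HalfLine.

(** * Euler's integral: finiteness, functional equation, positivity *)

Section GammaFunction.
Context {R : realType}.
Local Notation mu := (@lebesgue_measure R).

Let gammaf (a t : R) := t `^ (a - 1) * expR (- t).

Lemma continuous_powR (a t : R) : 0 < t -> {for t, continuous (@powR R ^~ a)}.
Proof.
move=> t0; apply: differentiable_continuous; apply/derivable1_diffP.
by case: (is_derive1_powR a t0).
Qed.

Let continuous_expRN : continuous (fun t : R => expR (- t)).
Proof.
move=> t; apply: (@continuous_comp _ _ _ (@GRing.opp R) expR).
  exact: oppr_continuous.
exact: continuous_expR.
Qed.

Let continuous_gammaf (a t : R) : 0 < t -> {for t, continuous (gammaf a)}.
Proof.
move=> t0; apply: cvgM; first exact: continuous_powR.
exact: continuous_expRN.
Qed.

Let gammaf_ge0 (a t : R) : 0 <= gammaf a t.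
Proof. by rewrite mulr_ge0 ?powR_ge0 ?expR_ge0. Qed.

(** An upper bound of t^a e^(-t/2) for t > 0: the maximum, reached at t = 2a, is (2a)^a e^(-a). *)
Let bnd (a : R) := (2 * a) `^ a.

Let expRhalf (t : R) := expR (- (t / 2)).

(* From [ln (t / 2a) <= t / 2a]. *)
Let gammaf_le (a t : R) : 0 < a -> 0 < t ->
  gammaf (a + 1) t <= bnd a * expRhalf t.
Proof.
move=> a0 t0; rewrite /gammaf /bnd /expRhalf addrK.
have -> : - t = - (t / 2) + - (t / 2) by lra.
rewrite expRD mulrA ler_wpM2r ?expR_ge0//.
rewrite expRN ler_pdivrMr ?expR_gt0//.
rewrite /powR !gt_eqF ?mulr_gt0// -expRD ler_expR.
have -> : ln t = ln (2 * a) + ln (t / (2 * a)).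
  rewrite -lnM ?posrE ?divr_gt0 ?mulr_gt0// mulrC divfK//.
  by rewrite gt_eqF ?mulr_gt0.
have -> : t / 2 = a * (t / (2 * a)) by field; rewrite gt_eqF.
rewrite -mulrDr ler_pM2l// lerD2l ltW// ln_sublinear//.
by rewrite divr_gt0 ?mulr_gt0.
Qed.

Let continuous_expRhalf : continuous expRhalf.
Proof.
move=> t; apply: (@continuous_comp _ _ _ (fun t : R => t / 2) (fun t => expR (- t))).
  exact: mulrr_continuous.
exact: continuous_expRN.
Qed.

Let cvg_expRhalf : expRhalf t @[t --> +oo] --> 0.
Proof.
apply: (@cvg_comp _ _ _ (fun t : R => t / 2) (fun t => expR (- t)) _ +oo);
  last exact: cvgr_expR.
by apply: gt0_cvgMly.
Qed.

Let dexpRhalf (t : R) : is_derive t 1 expRhalf (- expRhalf t / 2).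
Proof.
have -> : expRhalf = expR \o ( *%R (- 2^-1)).
  by apply/funext => x; rewrite /expRhalf /= mulNr mulrC.
have -> : - (expR \o *%R (- 2^-1)) t / 2 = expR (- 2^-1 * t) * (- 2^-1).
  by rewrite /= mulrN mulNr.
apply: is_derive1_comp.
apply: is_derive_eq (is_deriveZ _ (is_derive_id _ _)) _.
by rewrite /GRing.scale /= mulr1.
Qed.

(* With C = [bnd a], t^a e^-t - 2 C e^(-t/2) is an antiderivative of
   a t^(a-1) e^-t + (C e^(-t/2) - t^a e^-t), a sum of two nonnegative functions:
   the fundamental theorem of calculus gives finiteness and, on comparing with
   the integral of C e^(-t/2), the functional equation. *)
Let Gamma_fin_rec (a : R) : 0 < a ->
  (\int[mu]_(t in `]0%R, +oo[) (gammaf a t)%:E)%E \is a fin_num /\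
  Gamma (a + 1) = a * Gamma a.
Proof.
move=> a0.
pose p t := bnd a * expRhalf t - gammaf (a + 1) t.
pose F t := gammaf (a + 1) t - 2 * bnd a * expRhalf t.
have expRhalf0 : expRhalf t @[t --> 0^'+] --> (1 : R).
  have -> : 1 = expRhalf 0 by rewrite /expRhalf mul0r oppr0 expR0.
  by apply: cvg_at_right_filter; exact: continuous_expRhalf.
have expRN0 : expR (- t) @[t --> 0^'+] --> (1 : R).
  have -> : 1 = expR (- 0) :> R by rewrite oppr0 expR0.
  by apply: cvg_at_right_filter; exact: continuous_expRN.
have F0 : F t @[t --> 0^'+] --> - (2 * bnd a).
  have -> : - (2 * bnd a) = 0 * 1 - 2 * bnd a * 1 by rewrite mul0r mulr1 sub0r.
  apply: cvgB; last by apply: cvgM => //; exact: cvg_cst.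
  by apply: cvgM => //; rewrite /= addrK; exact: powR_cvg0.
have Fy : F t @[t --> +oo] --> (0 : R).
  have -> : 0 = 0 - 2 * bnd a * 0 :> R by rewrite mulr0 subr0.
  apply: cvgB; last by apply: cvgM => //; exact: cvg_cst.
  have b0 : bnd a * expRhalf t @[t --> +oo] --> (0 : R).
    by rewrite -[0](mulr0 (bnd a)); apply: cvgM => //; exact: cvg_cst.
  apply: squeeze_cvgr b0; last exact: cvg_cst.
  by near=> t; rewrite gammaf_ge0 gammaf_le.
have dF (t : R) : 0 < t -> is_derive t 1 F (a * gammaf a t + p t).
  move=> t0; have dp := is_derive1_powR a t0.
  have dE : is_derive t 1 (expR \o -%R) (- expR (- t)).
    by apply: is_derive_eq (is_derive1_comp _ _) _; rewrite ?mulrN1.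
  have -> : F = ((@powR R ^~ a) * (expR \o -%R)) - (2 * bnd a) *: expRhalf.
    by apply/funext => x; rewrite /F /gammaf addrK.
  apply: is_derive_eq
    (is_deriveB (is_deriveM dp dE) (is_deriveZ _ (dexpRhalf t))) _.
  rewrite /p /gammaf addrK /GRing.scale /=.
  by rewrite /expRhalf; field.
have p_ge0 (t : R) : 0 < t -> 0 <= p t by move=> t0; rewrite subr_ge0 gammaf_le.
have cp (t : R) : 0 < t -> {for t, continuous p}.
  move=> t0; apply: cvgB; last exact: continuous_gammaf.
  by apply: cvgM; [exact: cvg_cst|exact: continuous_expRhalf].
have cag (t : R) : 0 < t -> {for t, continuous (fun t => a * gammaf a t)}.
  by move=> t0; apply: cvgM; [exact: cvg_cst|exact: continuous_gammaf].
have mg b : measurable_fun (`]0, +oo[%classic : set R) (EFin \o gammaf b).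
  apply: continuous_measurable_itv0y => t.
  exact: continuous_gammaf.
have mp : measurable_fun (`]0, +oo[%classic : set R) (EFin \o p).
  exact: continuous_measurable_itv0y cp.
have itvgt0 (t : R) : `]0%R, +oo[%classic t -> 0 < t.
  by rewrite /= in_itv /= andbT.
have apE : (a%:E * \int[mu]_(t in `]0%R, +oo[) (gammaf a t)%:E
    + \int[mu]_(t in `]0%R, +oo[) (p t)%:E = (2 * bnd a)%:E)%E.
  have <- : (\int[mu]_(t in `]0%R, +oo[) (a%:E * (gammaf a t)%:E)
      = a%:E * \int[mu]_(t in `]0%R, +oo[) (gammaf a t)%:E)%E.
    apply: ge0_integralZl_EFin.
    - exact: measurable_itv.
    - by move=> t _; rewrite lee_fin.
    - exact: mg.
    - exact: ltW.
  rewrite -ge0_integralD//.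
  - under eq_integral do rewrite -EFinM -EFinD.
    rewrite (ge0_FTC_itv0y _ _ dF F0 Fy) ?sub0r ?opprK//.
    + by move=> t t0; rewrite addr_ge0 ?p_ge0// mulr_ge0// ltW.
    + by move=> t t0; apply: cvgD; [exact: cag|exact: cp].
  - by move=> t _; rewrite -EFinM lee_fin mulr_ge0// ltW.
  - exact: continuous_measurable_itv0y cag.
  - by move=> t /itvgt0 t0; rewrite lee_fin p_ge0.
have gpE : (\int[mu]_(t in `]0%R, +oo[) (gammaf (a + 1) t)%:E
    + \int[mu]_(t in `]0%R, +oo[) (p t)%:E = (2 * bnd a)%:E)%E.
  rewrite -ge0_integralD//.
  - under eq_integral do rewrite -EFinD /p subrKC.
    have dG (t : R) : 0 < t ->
        is_derive t 1 (fun t => - (2 * bnd a) * expRhalf t) (bnd a * expRhalf t).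
      move=> _.
      apply: is_derive_eq (is_deriveZ (- (2 * bnd a)) (dexpRhalf t)) _.
      by rewrite /GRing.scale /=; field.
    rewrite (ge0_FTC_itv0y _ _ dG
      (A := - (2 * bnd a) * 1) (B := - (2 * bnd a) * 0)).
    + by rewrite mulr0 mulr1 sub0r opprK.
    + by move=> t t0; rewrite mulr_ge0 ?powR_ge0 ?expR_ge0.
    + by move=> t t0; apply: cvgM; [exact: cvg_cst|exact: continuous_expRhalf].
    + by apply: cvgM => //; exact: cvg_cst.
    + by apply: cvgM => //; exact: cvg_cst.
  - by move=> t _; rewrite lee_fin.
  - exact: mg.
  - by move=> t /itvgt0 t0; rewrite lee_fin p_ge0.
(* Nonnegative extended reals with a finite sum are finite, and a > 0 prevents a * x from hiding an
   infinite x. Once all terms are real, z cancels. *)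
have ereal_cancel (x y z : \bar R) c : (0 <= x -> 0 <= y -> 0 <= z ->
    a%:E * x + z = c%:E -> y + z = c%:E ->
    x \is a fin_num /\ fine y = (a * fine x)%R)%E.
  move: x y z => [x| |] [y| |] [z| |] //=; rewrite ?gt0_muley ?lte_fin//.
  move=> _ _ _ [axz] [yz]; split => //.
  by apply: (addIr z); rewrite axz yz.
have p0 : (0 <= \int[mu]_(t in `]0%R, +oo[) (p t)%:E)%E.
  by apply: integral_ge0 => t /itvgt0 t0; rewrite lee_fin p_ge0.
have g0 b : (0 <= \int[mu]_(t in `]0%R, +oo[) (gammaf b t)%:E)%E.
  by apply: integral_ge0 => t _; rewrite lee_fin.
exact: ereal_cancel (g0 a) (g0 (a + 1)) p0 apE gpE.
Unshelve. all: by end_near. Qed.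

Lemma Gamma_fin_num (a : R) : 0 < a ->
  (\int[mu]_(t in `]0%R, +oo[) (t `^ (a - 1) * expR (- t))%:E)%E \is a fin_num.
Proof. by case/Gamma_fin_rec. Qed.

Lemma GammaS (a : R) : 0 < a -> Gamma (a + 1) = a * Gamma a.
Proof. by case/Gamma_fin_rec. Qed.

Lemma Gamma1 : Gamma (1 : R) = 1.
Proof.
rewrite /Gamma /Rintegral.
have dN (t : R) : 0 < t -> is_derive t 1 (- (expR \o -%R)) (gammaf 1 t).
  move=> _.
  apply: is_derive_eq (is_deriveN (is_derive1_comp _ _)) _.
  by rewrite /gammaf subrr powRr0; ring.
rewrite (ge0_FTC_itv0y _ _ dN (A := - 1) (B := - 0)).
- by rewrite oppr0 sub0r opprK.
- by move=> t _.
- exact: continuous_gammaf.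
- apply: cvgN; have -> : 1 = expR (- 0) :> R by rewrite oppr0 expR0.
  by apply: cvg_at_right_filter; exact: continuous_expRN.
- by apply: cvgN; exact: cvgr_expR.
Qed.

(** The functional equation moves the question to a + 1, where the exponent a of t is positive: on
    [1, 2] the integrand is then at least e^(-2). Finiteness matters as well, since [fine] sends an
    infinite integral to 0. *)
Lemma Gamma_gt0 (a : R) : 0 < a -> 0 < Gamma a.
Proof.
move=> a0; rewrite -(pmulr_rgt0 _ a0) -GammaS//.
apply: fine_gt0; apply/andP; split; last first.
  have := Gamma_fin_num (addr_gt0 a0 ltr01).
  rewrite ge0_fin_numE//; apply: integral_ge0 => t _; rewrite lee_fin.
  exact: gammaf_ge0.
apply: (@lt_le_trans _ _ (\int[mu]_(t in `[1%R, 2%R]) (expR (- 2))%:E)%E).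
  rewrite integral_cst//= lebesgue_measure_itv/= lte_fin ltr1n.
  rewrite -EFinD -EFinM lte_fin.
  by rewrite mulr_gt0 ?expR_gt0//; lra.
apply: (@le_trans _ _ (\int[mu]_(t in `[1%R, 2%R]) (gammaf (a + 1) t)%:E)%E).
  apply: ge0_le_integral => //=.
  - apply: measurable_funS
      (continuous_measurable_itv0y (@continuous_gammaf (a + 1))) => // t.
    by rewrite /= !in_itv /= andbT => /andP[+ _]; apply: lt_le_trans.
  - move=> t; rewrite in_itv /= => /andP[t1 t2]; rewrite lee_fin /gammaf addrK.
    rewrite -[leLHS]mul1r ler_pM// ?expR_ge0// ?ler_expR ?lerN2//.
    by rewrite -(powRr0 t) ler_powR// ltW.
apply: ge0_subset_integral => //=.
- apply: continuous_measurable_itv0y; exact: continuous_gammaf.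
- by move=> t _; rewrite lee_fin.
- by move=> t; rewrite /= !in_itv /= andbT => /andP[+ _]; apply: lt_le_trans.
Qed.

End GammaFunction.

(** * Pochhammer symbols and the series 0F1 *)

Section Hyp0F1.
Context {R : realType}.

Lemma poch0 (b : R) : 0 < b -> poch b 0 = 1.
Proof. by move=> b0; rewrite /poch addr0 divff// gt_eqF// Gamma_gt0. Qed.

Lemma pochS (b : R) l : 0 < b -> poch b l.+1 = (b + l%:R) * poch b l.
Proof.
by move=> b0; rewrite /poch -natr1 addrA GammaS ?ltr_wpDr// mulrA.
Qed.

Lemma poch_gt0 (b : R) l : 0 < b -> 0 < poch b l.
Proof.
move=> b0; elim: l => [|l IH]; first by rewrite poch0.
by rewrite pochS// mulr_gt0// ltr_wpDr.
Qed.

(** The first two values are 1 and b, and every later factor b + l is at least 1. This bounds the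
    coefficients of 0F1 by a multiple of 1/i!. *)
Lemma poch_ge (b : R) l : 0 < b -> Num.min 1 b <= poch b l.
Proof.
move=> b0; case: l => [|l]; first by rewrite poch0// ge_min lexx.
elim: l => [|l IH]; first by rewrite pochS// poch0// addr0 mulr1 ge_min lexx orbT.
rewrite pochS// (le_trans IH)// ler_peMl ?(ltW (poch_gt0 _ _))//.
by rewrite -natr1 addrA lerDr addr_ge0// ltW.
Qed.

Let coef (b : R) i := (poch b i)^-1 * (i`!%:R)^-1.

Let coef_ge0 (b : R) i : 0 < b -> 0 <= coef b i.
Proof. by move=> b0; rewrite mulr_ge0 ?invr_ge0 ?ler0n// ltW ?poch_gt0. Qed.

(* This class of coefficient sequences is stable under [pseries_diffs]. *)
Let subfact (M : R) (c : R^nat) := forall i, 0 <= c i <= M * (i`!%:R)^-1.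

(** The constant M is preserved because (i+1)/(i+1)! = 1/i!. *)
Let subfact_diffs M c : subfact M c -> subfact M (pseries_diffs c).
Proof.
move=> cM i; have /andP[c0 cle] := cM i.+1; rewrite /pseries_diffs mulr_ge0//=.
apply: le_trans (ler_wpM2l _ cle) _ => //.
by rewrite factS natrM invfM mulrCA mulVKf ?pnatr_eq0.
Qed.

Let subfact_cvg M c x : subfact M c -> cvgn (pseries c x).
Proof.
move=> cM; apply: normed_cvg.
apply: (@series_le_cvg _ _ (M *: exp_coeff `|x|)).
- by move=> n; exact: normr_ge0.
(* The sign of M comes from index 0, where 0 <= c 0 <= M. *)
- move=> n; rewrite mulr_ge0 ?exp_coeff_ge0//.
  by have /andP[/le_trans/[apply]] := cM 0; rewrite fact0 invr1 mulr1.
- move=> n; have /andP[c0 cle] := cM n.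
  have -> : (M *: exp_coeff `|x|) n = M * (n`!%:R)^-1 * `|x| ^+ n.
    by rewrite exp_coeffE -mulrA.
  rewrite /= normrM normrX ger0_norm//.
  by rewrite ler_wpM2r ?exprn_ge0.
by apply: is_cvg_seriesZ; exact: is_cvg_series_exp_coeff.
Qed.

Let subfact_coef b : 0 < b -> subfact (Num.min 1 b)^-1 (coef b).
Proof.
move=> b0 i; rewrite coef_ge0//= ler_wpM2r ?invr_ge0//.
by rewrite lef_pV2 ?posrE ?poch_ge ?poch_gt0// lt_min ltr01.
Qed.

(** Continuity follows from termwise differentiability, which asks that the series and its first two
    formal derivatives converge at a point of modulus larger than |x|; here |x| + 1. *)
Lemma continuous_hyp0F1 (b : R) : 0 < b -> continuous (hyp0F1 b).
Proof.
move=> b0 x; have cM := subfact_coef b0.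
apply: differentiable_continuous; apply/derivable1_diffP.
have xK : `|x| < `| `|x| + 1| by rewrite [ltRHS]ger0_norm ?ltrDl ?addr_ge0.
have [] // := pseries_snd_diffs (subfact_cvg cM)
  (subfact_cvg (subfact_diffs cM))
  (subfact_cvg (subfact_diffs (subfact_diffs cM))) xK.
Qed.

(** The term of index 0 is 1 and the others are nonnegative. This serves the positivity of the
    density's factors at the vertices. *)
Lemma hyp0F1_ge1 (b x : R) : 0 < b -> 0 <= x -> 1 <= hyp0F1 b x.
Proof.
move=> b0 x0; rewrite /hyp0F1 -/(coef b).
apply: limr_ge; first exact: subfact_cvg (subfact_coef b0).
near=> n.
have n0 : (0 < n)%N by near: n; exists 1%N.
rewrite /pseries /series/= big_ltn// /coef poch0// fact0 invr1 !mulr1 lerDl.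
by apply: sumr_ge0 => i _; rewrite mulr_ge0 ?coef_ge0 ?exprn_ge0.
Unshelve. all: by end_near. Qed.

Lemma hyp0F1_0 (b : R) : 0 < b -> hyp0F1 b 0 = 1.
Proof.
move=> b0; rewrite /hyp0F1; apply: (@cvg_lim _ _) => //.
apply: cvg_near_cst; near=> n.
have n0 : (0 < n)%N by near: n; exists 1%N.
rewrite /pseries /series/= big_ltn// poch0// fact0 invr1 !mulr1.
rewrite big_nat_cond big1 ?addr0//.
by move=> i /andP[/andP[i0 _] _]; rewrite expr0n gtn_eqF// mulr0.
Unshelve. all: by end_near. Qed.

End Hyp0F1.

(** * Real powers at 0+ *)

Section PowerLimit.
Context {R : realType}.

(** Encoding the limit of t^a as a single extended real lets all the cases at a vertex be read off
    from products of such values. *)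
Definition powR_lim0 (a : R) : \bar R :=
  if a < 0 then +oo%E else if a == 0 then 1%E else 0%E.

Lemma powR_cvg_at0 (a : R) : (t `^ a)%:E @[t --> 0^'+] --> powR_lim0 a.
Proof.
rewrite /powR_lim0; have [a0|a0|->] := ltgtP a 0; last first.
- under eq_fun do rewrite powRr0; exact: cvg_cst.
- by apply: cvg_EFin; [exact: nearW|exact: powR_cvg0].
apply/cvgeryP.
have -> : (fun t : R => t `^ a) = (fun t => (t `^ (- a))^-1).
  by apply/funext => t; rewrite -powRN opprK.
apply/cvgrVy; first by near=> t; rewrite powR_gt0.
by apply: powR_cvg0; rewrite oppr_gt0.
Unshelve. all: by end_near. Qed.

Lemma mule_def_powR_lim0 (k a : R) : 0 < k -> (k%:E *? powR_lim0 a)%E.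
Proof.
move=> k0; rewrite /powR_lim0; case: ifP => _.
  by apply: mule_def_neq0_infty => //; rewrite eqe gt_eqF.
by case: ifP => _; apply: mule_def_fin.
Qed.

End PowerLimit.

(** * Limits at a vertex, for two linear forms [P] and [Q] *)

Section VertexLimits.
Context {R : realType} (v : R * R) (P Q f g : R * R -> R) (a b c : R).
Hypotheses (PZ : forall t w, P (t * w.1, t * w.2) = t * P w)
           (QZ : forall t w, Q (t * w.1, t * w.2) = t * Q w)
           (contP : continuous P) (contQ : continuous Q)
           (simplexP : forall x : R * R, simplex2 x -> 0 < P (x - v))
           (simplexQ : forall x, simplex2 x -> 0 < Q (x - v))
           (fE : forall x, f x = g x * (P (x - v) `^ a * Q (x - v) `^ b))
           (g_cvg : g x @[x --> v] --> c) (c_gt0 : 0 < c).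

Let shift (t : R) (w : R * R) : R * R := (v.1 + t * w.1, v.2 + t * w.2).

Let shiftB t w : shift t w - v = (t * w.1, t * w.2).
Proof. by apply/eqP; rewrite /shift xpair_eqE/= !(addrC _ (t * _)) !addrK !eqxx. Qed.

(** Some point v + t u with t > 0 lies in the simplex, and there the forms equal t P(u) and t
    Q(u). *)
Let inward_gt0 u : inward v u -> 0 < P u /\ 0 < Q u.
Proof.
move=> vu; have [t [t0 st]] : exists t, 0 < t /\ simplex2 (shift t u).
  have /filter_ex[t [? ?]] : \forall t \near 0^'+, 0 < t /\ simplex2 (shift t u).
    by near=> t; split => //; near: t; exact: vu.
  by exists t.
have := simplexP st; have := simplexQ st.
by rewrite shiftB PZ QZ !pmulr_rgt0.
Unshelve. all: by end_near. Qed.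

Let cvg_shift (T : Type) (F : set_system T) (FF : Filter F)
    (t : T -> R) (w : T -> R * R) (u : R * R) :
  t x @[x --> F] --> 0 -> w x @[x --> F] --> u -> shift (t x) (w x) @[x --> F] --> v.
Proof.
move=> t0 wu.
suff : shift (t x) (w x) @[x --> F] --> (v.1 + 0 * u.1, v.2 + 0 * u.2).
  by rewrite !mul0r !addr0 -surjective_pairing.
have c1 : v.1 + t x * (w x).1 @[x --> F] --> v.1 + 0 * u.1.
  apply: cvgD; first exact: cvg_cst.
  by apply: cvgM => //; apply: cvg_comp wu _; exact: cvg_fst.
have c2 : v.2 + t x * (w x).2 @[x --> F] --> v.2 + 0 * u.2.
  apply: cvgD; first exact: cvg_cst.
  by apply: cvgM => //; apply: cvg_comp wu _; exact: cvg_snd.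
exact: cvg_pair c1 c2.
Qed.

(** The coefficient of t^(a+b) in the leading behaviour of [f] in the direction u. *)
Let dirC (u : R * R) := c * (P u `^ a * Q u `^ b).

Let dirC_gt0 u : inward v u -> 0 < dirC u.
Proof. by case/inward_gt0 => ? ?; rewrite !mulr_gt0 ?powR_gt0. Qed.

Lemma lim_dir_vertex u : inward v u ->
  lim_dir f v u ((dirC u)%:E * powR_lim0 (a + b))%E.
Proof.
move=> vu; have [Pu Qu] := inward_gt0 vu.
have FF : Filter (filter_prod (0:R)^'+ (nbhs u)) by exact: filter_prod_filter.
have cvg1 : p.1 @[p --> filter_prod (0:R)^'+ (nbhs u)] --> (0:R)^'+ by exact: cvg_fst.
have cvg2 : p.2 @[p --> filter_prod (0:R)^'+ (nbhs u)] --> u by exact: cvg_snd.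
have PF := cvg_comp _ _ cvg2 (@contP u).
have QF := cvg_comp _ _ cvg2 (@contQ u).
rewrite /lim_dir.
(* The vector w only tends to u, so the signs of P(w) and Q(w) come from continuity. They allow (t
   P(w))^a and (t Q(w))^b to be split. *)
have near_pos : \forall p \near filter_prod (0:R)^'+ (nbhs u),
    [/\ 0 < p.1, 0 < P p.2 & 0 < Q p.2].
  near=> p; split; near: p.
  - exact: cvg1 (nbhs_right_gt 0).
  - exact: cvgr_gt PF _ Pu.
  - exact: cvgr_gt QF _ Qu.
apply: (@cvg_trans _ ((g (shift p.1 p.2) * (P p.2 `^ a * Q p.2 `^ b))%:E
    * (p.1 `^ (a + b))%:E @[p --> filter_prod (0:R)^'+ (nbhs u)])%E).
  apply: near_eq_cvg; near=> p.
  have [p0 Pp Qp] : [/\ 0 < p.1, 0 < P p.2 & 0 < Q p.2] by near: p.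
  rewrite /= -EFinM -/(shift p.1 p.2); congr (_%:E).
  rewrite fE shiftB PZ QZ !powRM ?ltW// powRD ?(gt_eqF p0) ?implybT//.
  by rewrite -[LHS]mulrA; congr (_ * _); rewrite [LHS]mulrC mulrACA.
apply: cvgeM.
- exact: mule_def_powR_lim0 (dirC_gt0 vu).
- apply: cvg_EFin; first exact: nearW.
  apply: cvgM.
    have cvg10 : p.1 @[p --> filter_prod (0:R)^'+ (nbhs u)] --> (0 : R).
      by apply: cvg_trans cvg1 _; exact: cvg_within.
    exact: (cvg_comp _ _ (cvg_shift FF cvg10 cvg2) g_cvg).
  apply: cvgM.
    exact: (cvg_comp _ _ PF (continuous_powR Pu)).
  exact: (cvg_comp _ _ QF (continuous_powR Qu)).
- exact: (cvg_comp fst (fun t : R => (t `^ (a + b))%:E) cvg1 (@powR_cvg_at0 R (a + b))).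
Unshelve. all: by end_near. Qed.

(** With no direction fixed, the two forms tend to 0+ at unrelated rates, so only the limits of the
    separate powers can be used. The hypothesis excludes 0 * oo. *)
Lemma lim_simplex_vertex : (powR_lim0 a *? powR_lim0 b)%E ->
  lim_simplex f v (c%:E * (powR_lim0 a * powR_lim0 b))%E.
Proof.
move=> ab.
have cvg_PQ (S : R * R -> R) : continuous S ->
    (forall t w, S (t * w.1, t * w.2) = t * S w) ->
    (forall x, simplex2 x -> 0 < S (x - v)) ->
    S (x - v) @[x --> within simplex2 (nbhs v)] --> (0 : R)^'+.
  move=> cS SZ sS.
  (* Homogeneity with factor 0 gives S(0) = 0. *)
  have S0 : S (v - v) = 0.
    by rewrite subrr; have := SZ 0 0; rewrite !mul0r.
  have cv : S (x - v) @[x --> v] --> (0 : R).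
    rewrite -S0.
    have xv : x - v @[x --> v] --> v - v.
      by apply: (@cvgB R (R * R)%type); [exact: cvg_id|exact: cvg_cst].
    exact: (cvg_comp _ _ xv (cS _)).
  (* The limit is one-sided because [S] is positive at x - v for x in the simplex. *)
  move=> A A0; rewrite /within /=.
  have : \forall x \near v, 0 < S (x - v) -> A (S (x - v)) by exact: cv _ A0.
  by apply: filterS => x Ax sx; apply/Ax/sS.
rewrite /lim_simplex.
have -> : (fun x => (f x)%:E) = (fun x => (g x)%:E *
    ((P (x - v) `^ a)%:E * (Q (x - v) `^ b)%:E))%E.
  by apply/funext => x; rewrite fE !EFinM.
apply: cvgeM.
(* In each of the nine sign patterns the product of the two limits is +oo, 1 or 0, and c is finite
   and nonzero. *)
- rewrite /powR_lim0; case: ifP => _; [|case: ifP => _];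
    (case: ifP => _; [|case: ifP => _]);
    rewrite ?(mulyy, mule1, mul1e, mule0, mul0e);
    by [apply: mule_def_fin|apply: mule_def_neq0_infty; rewrite ?eqe ?gt_eqF].
- apply: cvg_EFin; first exact: nearW.
  by apply: cvg_trans g_cvg; apply: cvg_app; exact: cvg_within.
- apply: cvgeM => //.
  + exact: (cvg_comp _ (fun t : R => (t `^ a)%:E) (cvg_PQ P contP PZ simplexP)
      (@powR_cvg_at0 R a)).
  + exact: (cvg_comp _ (fun t : R => (t `^ b)%:E) (cvg_PQ Q contQ QZ simplexQ)
      (@powR_cvg_at0 R b)).
Qed.

(** Both limits can be computed along the ray v + t u, which stays in the simplex for small t > 0;
    limits in the extended reals are unique. *)
Lemma lim_simplex_dir (l l' : \bar R) u :
  inward v u -> lim_simplex f v l -> lim_dir f v u l' -> l = l'.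
Proof.
move=> vu fl fl'.
have t0 : t @[t --> (0 : R)^'+] --> (0 : R) by exact: cvg_within.
have uu : u @[t --> (0 : R)^'+] --> u by exact: cvg_cst.
have ray : (f (shift t u))%:E @[t --> (0 : R)^'+] --> l.
  have sv := cvg_shift _ t0 uu.
  apply: (cvg_comp (fun t => shift t u) (fun x => (f x)%:E) _ fl).
  move=> A; rewrite /within /= => A0.
  near=> t.
  have st : simplex2 (shift t u) by near: t; exact: vu.
  move: st; rewrite -/(_ -> _); near: t; exact: sv _ A0.
have ray' : (f (shift t u))%:E @[t --> (0 : R)^'+] --> l'.
  have pr : (t, u) @[t --> (0 : R)^'+] --> filter_prod (0 : R)^'+ (nbhs u).
    have id0 : t @[t --> (0 : R)^'+] --> (0 : R)^'+ by exact: cvg_id.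
    exact: cvg_pair id0 uu.
  exact: (cvg_comp _ _ pr fl').
by rewrite -(cvg_lim _ ray)// -(cvg_lim _ ray').
Unshelve. all: by end_near. Qed.

(** Since b = -a, the limit in a direction w is c (P(w)/Q(w))^a. Ratios 1 and 2 give c and c 2^a,
    which differ because a is nonzero and c > 0. *)
Lemma no_limit_vertex u u' : a + b = 0 -> a != 0 ->
  inward v u -> inward v u' -> P u = Q u -> P u' = 2 * Q u' -> no_limit f v.
Proof.
move=> ab a0 vu vu' Pu Pu'.
have l0 : powR_lim0 (a + b) = 1%E by rewrite /powR_lim0 ab ltxx eqxx.
have dE w : inward v w -> lim_dir f v w (dirC w)%:E.
  by move=> vw; rewrite -[X in lim_dir _ _ _ X]mule1 -l0; exact: lim_dir_vertex.
have neq : (dirC u)%:E <> (dirC u')%:E.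
  have [_ Qu] := inward_gt0 vu; have [_ Qu'] := inward_gt0 vu'.
  have bE : b = - a by apply/eqP; rewrite -addr_eq0 addrC ab.
  have dirCE w r : 0 < r -> 0 < Q w -> P w = r * Q w -> dirC w = c * r `^ a.
    move=> r0 Qw Pw; rewrite /dirC Pw bE powRM ?ltW// powRN mulfK//.
    by rewrite gt_eqF// powR_gt0.
  rewrite (dirCE u 1)// ?mul1r// (dirCE u' 2)// => -[].
  rewrite powR1 mulr1 -{1}[c]mulr1 => /(mulfI (lt0r_neq0 c_gt0))/esym/eqP.
  rewrite powR_eq1 (negbTE a0) orbF => /orP[/eqP|]; lra.
split; last by exists (fun w => (dirC w)%:E); split => //; exists u, u'.
move=> [l fl]; apply: neq.
by rewrite -(lim_simplex_dir vu fl (dE _ vu)) (lim_simplex_dir vu' fl (dE _ vu')).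
Qed.

(** The form shared by the three vertices: [al] and [be] are the Dirichlet parameters of the
    vanishing coordinates. The closed form [d] of g(v) is requested only for al = be = 1, the case
    in which it is used. *)
Lemma vertex_limits u u' al be d :
  inward v u -> inward v u' -> P u = Q u -> P u' = 2 * Q u' ->
  a = al - 1 -> b = be - 1 -> (al = 1 -> be = 1 -> c = d) ->
  [/\ al + be < 2 ->
        lim_alldir f v +oo%E /\ (al <= 1 /\ be <= 1 -> lim_simplex f v +oo%E),
      al + be = 2 ->
        (al = 1 /\ be = 1 -> lim_simplex f v d%:E) /\
        (~ (al = 1 /\ be = 1) -> no_limit f v)
    & al + be > 2 ->
        lim_alldir f v 0%E /\ (1 <= al /\ 1 <= be -> lim_simplex f v 0%E)].
Proof.
move=> vu vu' Pu Pu' aE bE cE.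
have lim00 : powR_lim0 (0 : R) = 1%E by rewrite /powR_lim0 ltxx eqxx.
split => albe.
- have limy (r : R) : r < 0 -> powR_lim0 r = +oo%E by rewrite /powR_lim0 => ->.
  have ab : a + b < 0 by lra.
  split=> [w vw|[al1 be1]].
    have := lim_dir_vertex vw; rewrite limy// gt0_muley// lte_fin.
    exact: dirC_gt0.
  (* Both exponents are at most 0 and their sum is negative: a zero exponent contributes 1 and
     forces the other to be strictly negative, so the product is always +oo. *)
  have /predU1P[a0|a0] : (a == 0) || (a < 0) by rewrite -le_eqVlt; lra.
    have b0 : b < 0 by lra.
    have := lim_simplex_vertex; rewrite a0 lim00 (limy _ b0) mul1e gt0_muley ?lte_fin//.
    by apply; apply: mule_def_neq0_infty => //; rewrite oner_eq0.
  have /predU1P[b0|b0] : (b == 0) || (b < 0) by rewrite -le_eqVlt; lra.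
    have := lim_simplex_vertex; rewrite b0 lim00 (limy _ a0) mule1 gt0_muley ?lte_fin//.
    by apply; apply: mule_def_infty_neq0 => //; rewrite oner_eq0.
  have := lim_simplex_vertex; rewrite (limy _ a0) (limy _ b0) mulyy.
  by rewrite gt0_muley ?lte_fin//; exact.
- split=> [[al1 be1]|albe1].
    have [a0 b0] : a = 0 /\ b = 0 by split; lra.
    rewrite -cE//; have := lim_simplex_vertex; rewrite a0 b0 lim00 !mule1.
    by apply; rewrite mule_def_fin.
  apply: no_limit_vertex Pu Pu' => //; first by lra.
  by apply/eqP => a0; apply: albe1; split; lra.
- have lim0 (r : R) : 0 < r -> powR_lim0 r = 0%E.
    by move=> r0; rewrite /powR_lim0 lt_gtF// gt_eqF.
  have ab : 0 < a + b by lra.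
  split=> [w vw|[al1 be1]].
    by have := lim_dir_vertex vw; rewrite lim0// mule0.
  have /predU1P[a0|a0] : (0 == a) || (0 < a) by rewrite -le_eqVlt; lra.
    have b0 : 0 < b by lra.
    have := lim_simplex_vertex; rewrite -a0 lim00 (lim0 _ b0) mul1e mule0.
    by apply; rewrite mule_def_fin.
  have /predU1P[b0|b0] : (0 == b) || (0 < b) by rewrite -le_eqVlt; lra.
    have := lim_simplex_vertex; rewrite -b0 lim00 (lim0 _ a0) mule1 mule0.
    by apply; rewrite mule_def_fin.
  have := lim_simplex_vertex; rewrite (lim0 _ a0) (lim0 _ b0) !mule0.
  by apply; rewrite mule_def_fin.
Qed.

End VertexLimits.

(** * The continuous positive factor of the density *)

Section Cofactor.
Context {R : realType} (a1 a2 a3 l1 l2 l3 : R).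
Hypotheses (a1_gt0 : 0 < a1) (a2_gt0 : 0 < a2) (a3_gt0 : 0 < a3)
  (l1_ge0 : 0 <= l1) (l2_ge0 : 0 <= l2) (l3_ge0 : 0 <= l3).

Let ap := a1 + a2 + a3.
Let lp := l1 + l2 + l3.

(* The density is the product of this function, for [r] the barycentric
   coordinate equal to 1 at a vertex and [ar] the matching parameter, by the
   powers of the two coordinates that vanish there. *)
Definition cofactor (r : R * R -> R) (ar : R) (x : R * R) : R :=
  Gamma ap / (Gamma a1 * Gamma a2 * Gamma a3) * r x `^ (ar - 1)
  * (hyp0F1 a1 (l1 / 4 * x.1) * hyp0F1 a2 (l2 / 4 * x.2)
     * hyp0F1 a3 (l3 / 4 * (1 - x.1 - x.2)) / hyp0F1 ap (lp / 4)).

(** Two values of k matter: 1 gives the third barycentric coordinate, 0 its linear part. *)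
Lemma continuous_cst_sub_fst_sub_snd (k : R) :
  continuous (fun x : R * R => k - x.1 - x.2).
Proof.
move=> x; apply: cvgB; last exact: cvg_snd.
by apply: cvgB; [exact: cvg_cst|exact: cvg_fst].
Qed.

Let continuous_hyp0F1_comp (al k : R) (r : R * R -> R) : 0 < al ->
  continuous r -> continuous (fun x => hyp0F1 al (k * r x)).
Proof.
move=> al0 cr x; have krx : k * r z @[z --> x] --> k * r x.
  by apply: cvgM; [exact: cvg_cst|exact: cr].
exact: (cvg_comp _ _ krx (@continuous_hyp0F1 R al al0 _)).
Qed.

Lemma cofactor_cvg (r : R * R -> R) (ar : R) (v : R * R) :
  continuous r -> 0 < r v ->
  cofactor r ar x @[x --> v] --> cofactor r ar v.
Proof.
move=> cr rv; rewrite /cofactor.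
apply: cvgM.
  apply: cvgM; first exact: cvg_cst.
  exact: (cvg_comp _ _ (cr v) (continuous_powR rv)).
apply: cvgM; last exact: cvg_cst.
apply: cvgM; last first.
  by apply: continuous_hyp0F1_comp a3_gt0 _ _; exact: continuous_cst_sub_fst_sub_snd.
apply: cvgM.
  by apply: continuous_hyp0F1_comp a1_gt0 _ _ => x; exact: cvg_fst.
by apply: continuous_hyp0F1_comp a2_gt0 _ _ => x; exact: cvg_snd.
Qed.

Let hyp0F1_gt0 (al x : R) : 0 < al -> 0 <= x -> 0 < hyp0F1 al x.
Proof. by move=> al0 x0; apply: lt_le_trans (hyp0F1_ge1 al0 x0). Qed.

Lemma cofactor_gt0 (r : R * R -> R) (ar : R) (v : R * R) :
  0 <= v.1 -> 0 <= v.2 -> v.1 + v.2 <= 1 -> 0 < r v -> 0 < cofactor r ar v.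
Proof.
move=> v1 v2 v12 rv; have ap0 : 0 < ap by rewrite !addr_gt0.
have v3 : 0 <= 1 - v.1 - v.2 by lra.
rewrite /cofactor !mulr_gt0 ?invr_gt0 ?mulr_gt0 ?powR_gt0 ?Gamma_gt0 ?hyp0F1_gt0//.
- by rewrite !mulr_ge0 ?invr_ge0.
- by rewrite !mulr_ge0 ?invr_ge0.
- by rewrite !mulr_ge0 ?invr_ge0.
- by rewrite divr_ge0 ?addr_ge0.
Qed.

(** With w = x - (1, 0), the coordinate 1 - x.1 - x.2 becomes 0 - w.1 - w.2, which is homogeneous in
    w. *)
Lemma pdf_vertex10 x : cncdir_pdf a1 a2 a3 l1 l2 l3 x = cofactor fst a1 x
  * ((x - (1, 0)).2 `^ (a2 - 1)
     * (0 - (x - (1, 0)).1 - (x - (1, 0)).2) `^ (a3 - 1)).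
Proof.
rewrite /cncdir_pdf /cofactor /= !subr0.
have -> : 0 - (x.1 - 1) - x.2 = 1 - x.1 - x.2 by ring.
ring.
Qed.

Lemma pdf_vertex01 x : cncdir_pdf a1 a2 a3 l1 l2 l3 x = cofactor snd a2 x
  * ((x - (0, 1)).1 `^ (a1 - 1)
     * (0 - (x - (0, 1)).1 - (x - (0, 1)).2) `^ (a3 - 1)).
Proof.
rewrite /cncdir_pdf /cofactor /= !subr0.
have -> : 0 - x.1 - (x.2 - 1) = 1 - x.1 - x.2 by ring.
ring.
Qed.

Lemma pdf_vertex00 x : cncdir_pdf a1 a2 a3 l1 l2 l3 x =
  cofactor (fun y => 1 - y.1 - y.2) a3 x
  * ((x - (0, 0)).1 `^ (a1 - 1) * (x - (0, 0)).2 `^ (a2 - 1)).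
Proof. by rewrite /cncdir_pdf /cofactor /= !subr0; ring. Qed.

Let Gamma_add2 (a : R) : 0 < a -> Gamma (a + 2) / Gamma a = a * (a + 1).
Proof.
move=> a0; have -> : a + 2 = a + 1 + 1 by ring.
rewrite !GammaS ?addr_gt0// mulrA mulfK ?gt_eqF ?Gamma_gt0//.
by rewrite mulrC.
Qed.

(** The power and two of the 0F1 factors are 1 at the vertex, and Gamma(1) = 1, so the constant
    reduces to Gamma(a1 + 2) / Gamma(a1) = a1 (a1 + 1). *)
Lemma cofactor_vertex10 : a2 = 1 -> a3 = 1 -> cofactor fst a1 (1, 0) =
  a1 * (a1 + 1) * (hyp0F1 a1 (l1 / 4) / hyp0F1 (a1 + 2) (lp / 4)).
Proof.
move=> e2 e3.
have G2 : Gamma a2 = 1 by rewrite e2 Gamma1.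
have G3 : Gamma a3 = 1 by rewrite e3 Gamma1.
have apE : ap = a1 + 2 by rewrite /ap e2 e3; ring.
rewrite /cofactor /= subrr subr0 !mulr0 (hyp0F1_0 a2_gt0) (hyp0F1_0 a3_gt0).
by rewrite G2 G3 powR1 !mulr1 apE Gamma_add2.
Qed.

Lemma cofactor_vertex01 : a1 = 1 -> a3 = 1 -> cofactor snd a2 (0, 1) =
  a2 * (a2 + 1) * (hyp0F1 a2 (l2 / 4) / hyp0F1 (a2 + 2) (lp / 4)).
Proof.
move=> e1 e3.
have G1 : Gamma a1 = 1 by rewrite e1 Gamma1.
have G3 : Gamma a3 = 1 by rewrite e3 Gamma1.
have apE : ap = a2 + 2 by rewrite /ap e1 e3; ring.
rewrite /cofactor /= subr0 subrr !mulr0 (hyp0F1_0 a1_gt0) (hyp0F1_0 a3_gt0).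
by rewrite G1 G3 powR1 !mulr1 !mul1r apE Gamma_add2.
Qed.

Lemma cofactor_vertex00 : a1 = 1 -> a2 = 1 ->
  cofactor (fun y => 1 - y.1 - y.2) a3 (0, 0) =
  a3 * (a3 + 1) * (hyp0F1 a3 (l3 / 4) / hyp0F1 (a3 + 2) (lp / 4)).
Proof.
move=> e1 e2.
have G1 : Gamma a1 = 1 by rewrite e1 Gamma1.
have G2 : Gamma a2 = 1 by rewrite e2 Gamma1.
have apE : ap = a3 + 2 by rewrite /ap e1 e2; ring.
rewrite /cofactor /= !subr0 !mulr0 (hyp0F1_0 a1_gt0) (hyp0F1_0 a2_gt0).
by rewrite G1 G2 powR1 !mulr1 !mul1r apE Gamma_add2.
Qed.

End Cofactor.

(** * Membership in the simplex and inward directions *)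

Section Simplex.
Context {R : realType}.
Implicit Types (x v u : R * R).

Lemma simplex2P x : simplex2 x <-> [/\ 0 < x.1, 0 < x.2 & x.1 + x.2 < 1].
Proof.
split=> [[/andP[? _] [/andP[? _] ?]]|[? ? ?]]; first by split.
by do ?split => //; apply/andP; split => //; lra.
Qed.

Lemma inwardI v u (e : R) : 0 < e -> (forall t, 0 < t < e ->
    [/\ 0 < v.1 + t * u.1, 0 < v.2 + t * u.2 &
        v.1 + t * u.1 + (v.2 + t * u.2) < 1]) ->
  inward v u.
Proof.
move=> e0 vu; near=> t; apply/simplex2P/vu; apply/andP; split => //.
Unshelve. all: by end_near. Qed.

End Simplex.

(** * Application to the three vertices *)

Theorem proposition3p14 (R : realType) (a1 a2 a3 l1 l2 l3 : R)
    (a1_gt0 : 0 < a1) (a2_gt0 : 0 < a2) (a3_gt0 : 0 < a3)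
    (l1_ge0 : 0 <= l1) (l2_ge0 : 0 <= l2) (l3_ge0 : 0 <= l3) :
  let f := cncdir_pdf a1 a2 a3 l1 l2 l3 in
  let lp := l1 + l2 + l3 in
  [/\ a2 + a3 < 2 ->
        lim_alldir f (1, 0) +oo%E /\
        (a2 <= 1 /\ a3 <= 1 -> lim_simplex f (1, 0) +oo%E),
      a2 + a3 = 2 ->
        (a2 = 1 /\ a3 = 1 ->
           lim_simplex f (1, 0)
             (a1 * (a1 + 1)
              * (hyp0F1 a1 (l1 / 4) / hyp0F1 (a1 + 2) (lp / 4)))%:E) /\
        (~ (a2 = 1 /\ a3 = 1) -> no_limit f (1, 0))
    & a2 + a3 > 2 ->
        lim_alldir f (1, 0) 0%E /\
        (1 <= a2 /\ 1 <= a3 -> lim_simplex f (1, 0) 0%E)] /\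
  [/\ a1 + a3 < 2 ->
        lim_alldir f (0, 1) +oo%E /\
        (a1 <= 1 /\ a3 <= 1 -> lim_simplex f (0, 1) +oo%E),
      a1 + a3 = 2 ->
        (a1 = 1 /\ a3 = 1 ->
           lim_simplex f (0, 1)
             (a2 * (a2 + 1)
              * (hyp0F1 a2 (l2 / 4) / hyp0F1 (a2 + 2) (lp / 4)))%:E) /\
        (~ (a1 = 1 /\ a3 = 1) -> no_limit f (0, 1))
    & a1 + a3 > 2 ->
        lim_alldir f (0, 1) 0%E /\
        (1 <= a1 /\ 1 <= a3 -> lim_simplex f (0, 1) 0%E)] /\
  [/\ a1 + a2 < 2 ->
        lim_alldir f (0, 0) +oo%E /\
        (a1 <= 1 /\ a2 <= 1 -> lim_simplex f (0, 0) +oo%E),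
      a1 + a2 = 2 ->
        (a1 = 1 /\ a2 = 1 ->
           lim_simplex f (0, 0)
             (a3 * (a3 + 1)
              * (hyp0F1 a3 (l3 / 4) / hyp0F1 (a3 + 2) (lp / 4)))%:E) /\
        (~ (a1 = 1 /\ a2 = 1) -> no_limit f (0, 0))
    & a1 + a2 > 2 ->
        lim_alldir f (0, 0) 0%E /\
        (1 <= a1 /\ 1 <= a2 -> lim_simplex f (0, 0) 0%E)].
Proof.
move=> f lp.
have contQ : continuous (fun w : R * R => 0 - w.1 - w.2).
  exact: continuous_cst_sub_fst_sub_snd.
have cont1 : continuous (fst : R * R -> R) by move=> x; exact: cvg_fst.
have cont2 : continuous (snd : R * R -> R) by move=> x; exact: cvg_snd.
(* For 0 < t < 1/4 all six test directions below stay inside the simplex; their entries are at most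
   3 in modulus. *)
have qgt0 : 0 < 4^-1 :> R by rewrite invr_gt0.
have fstZ (t : R) (w : R * R) : (t * w.1, t * w.2).1 = t * w.1 by [].
have sndZ (t : R) (w : R * R) : (t * w.1, t * w.2).2 = t * w.2 by [].
have thdZ (t : R) (w : R * R) :
  0 - (t * w.1, t * w.2).1 - (t * w.1, t * w.2).2 = t * (0 - w.1 - w.2).
  by rewrite /=; ring.
have cont3 := @continuous_cst_sub_fst_sub_snd R 1.
split; [|split].
- have c_gt0 : 0 < cofactor a1 a2 a3 l1 l2 l3 fst a1 (1, 0).
    by apply: cofactor_gt0 => //=; lra.
  have g_cvg : cofactor a1 a2 a3 l1 l2 l3 fst a1 x @[x --> ((1, 0) : R * R)]
      --> cofactor a1 a2 a3 l1 l2 l3 fst a1 (1, 0).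
    by apply: cofactor_cvg => //=; lra.
  (* The forms w.2 and 0 - w.1 - w.2 take the values 1, 1 at (-2, 1) and 2, 1 at (-3, 2), which
     gives the ratios 1 and 2. *)
  have main := @vertex_limits R (1, 0) snd (fun w => 0 - w.1 - w.2) f _
    (a2 - 1) (a3 - 1) _ sndZ thdZ cont2 contQ _ _ (pdf_vertex10 a1 a2 a3 l1 l2 l3)
    g_cvg c_gt0
    (-2, 1) (-3, 2) a2 a3.
  apply: main.
  + by move=> x /simplex2P[? ? ?] /=; lra.
  + by move=> x /simplex2P[? ? ?] /=; lra.
  + by apply: (inwardI qgt0) => t /andP[? ?] /=; split; lra.
  + by apply: (inwardI qgt0) => t /andP[? ?] /=; split; lra.
  + by rewrite /=; lra.
  + by rewrite /=; lra.
  + by [].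
  + by [].
  + exact: cofactor_vertex10.
- have c_gt0 : 0 < cofactor a1 a2 a3 l1 l2 l3 snd a2 (0, 1).
    by apply: cofactor_gt0 => //=; lra.
  have g_cvg : cofactor a1 a2 a3 l1 l2 l3 snd a2 x @[x --> ((0, 1) : R * R)]
      --> cofactor a1 a2 a3 l1 l2 l3 snd a2 (0, 1).
    by apply: cofactor_cvg => //=; lra.
  (* The same directions with the coordinates exchanged. *)
  have main := @vertex_limits R (0, 1) fst (fun w => 0 - w.1 - w.2) f _
    (a1 - 1) (a3 - 1) _ fstZ thdZ cont1 contQ _ _ (pdf_vertex01 a1 a2 a3 l1 l2 l3)
    g_cvg c_gt0
    (1, -2) (2, -3) a1 a3.
  apply: main.
  + by move=> x /simplex2P[? ? ?] /=; lra.
  + by move=> x /simplex2P[? ? ?] /=; lra.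
  + by apply: (inwardI qgt0) => t /andP[? ?] /=; split; lra.
  + by apply: (inwardI qgt0) => t /andP[? ?] /=; split; lra.
  + by rewrite /=; lra.
  + by rewrite /=; lra.
  + by [].
  + by [].
  + exact: cofactor_vertex01.
- have c_gt0 : 0 < cofactor a1 a2 a3 l1 l2 l3 (fun y => 1 - y.1 - y.2) a3 (0, 0).
    by apply: cofactor_gt0 => //=; lra.
  have g_cvg : cofactor a1 a2 a3 l1 l2 l3 (fun y => 1 - y.1 - y.2) a3 x
      @[x --> ((0, 0) : R * R)] -->
      cofactor a1 a2 a3 l1 l2 l3 (fun y => 1 - y.1 - y.2) a3 (0, 0).
    by apply: cofactor_cvg => //=; lra.
  (* At the origin the forms are the coordinates themselves, so the directions display the ratios 1
     and 2 directly. *)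
  have main := @vertex_limits R (0, 0) fst snd f _ (a1 - 1) (a2 - 1) _
    fstZ sndZ cont1 cont2 _ _ (pdf_vertex00 a1 a2 a3 l1 l2 l3)
    g_cvg c_gt0
    (1, 1) (2, 1) a1 a2.
  apply: main.
  + by move=> x /simplex2P[? ? ?] /=; lra.
  + by move=> x /simplex2P[? ? ?] /=; lra.
  + by apply: (inwardI qgt0) => t /andP[? ?] /=; split; lra.
  + by apply: (inwardI qgt0) => t /andP[? ?] /=; split; lra.
  + by rewrite /=; lra.
  + by rewrite /=; lra.
  + by [].
  + by [].
  + exact: cofactor_vertex00.
Qed.
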